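(* Let $d_{0,V}$ denote the distance of $x_0$ to $\mathcal S^*(V,T)$ and let $\rho,\epsilon>0$ be given tolerances. Then Algorithm 2 (the inexact partial inverse method for $(T,V)$ described in the context, started at $x_0$ with parameter $\sigma\in[0,1[$) finds $x,u\in\mathcal H$ and $\varepsilon>0$ satisfying $$u\in T^{\varepsilon}(x),\qquad \max\{\|x-P_V(x)\|,\ \|u-P_{V^\perp}(u)\|\}\le\rho,\qquad \varepsilon\le\epsilon$$ in at most $$\mathcal O\left(\max\left\{\left\lceil\frac{d_{0,V}}{\rho}\right\rceil,\left\lceil\frac{d_{0,V}^2}{\epsilon}\right\rceil\right\}\right)$$ iterations.
   Context: $\mathcal H$ is a real Hilbert space, $T:\mathcal H\rightrightarrows\mathcal H$ is maximal monotone, $V\subseteq\mathcal H$ is a closed subspace, and $P_V,P_{V^\perp}$ are the orthogonal projections onto $V$ and $V^\perp$. For $\varepsilon\ge0$ the $\varepsilon$-enlargement of $T$ is $T^\varepsilon(x):=\{v\in\mathcal H:\langle v'-v,x'-x\rangle\ge-\varepsilon\ \ \forall (x',v')\text{ with }v'\in T(x')\}$. The problem is to find $x\in V$, $u\in V^\perp$ with $u\in T(x)$; its solution set is $\mathcal S^*(V,T):=\{z\in\mathcal H:\ z=x+u \text{ for some } x\in V,\ u\in V^\perp \text{ with } u\in T(x)\}$, assumed nonempty. Algorithm 2: given $x_0\in\mathcal H$ and $\sigma\in[0,1[$, for $k=1,2,\dots$ choose any $(\tilde x_k,u_k,\varepsilon_k)\in\mathcal H\times\mathcal H\times\mathbb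 R_+$ such that $$u_k\in T^{\varepsilon_k}(\tilde x_k),\qquad \|u_k+\tilde x_k-x_{k-1}\|^2+2\varepsilon_k\le\sigma^2\|P_V(\tilde x_k)+P_{V^\perp}(u_k)-x_{k-1}\|^2,$$ and set $x_k=x_{k-1}-[P_V(u_k)+P_{V^\perp}(\tilde x_k)]$. The ergodic averages are $\tilde x_k^a:=\frac1k\sum_{\ell=1}^k\tilde x_\ell$ and $u_k^a:=\frac1k\sum_{\ell=1}^ku_\ell$. Convention: ''finds $x,u,\varepsilon$ in at most $\mathcal O(N)$ iterations'' means that there is a constant $C$ depending only on $\sigma$ such that for some $k\le C\max\{1,N\}$ the requirements hold, for some $\varepsilon>0$, with $(x,u)$ equal to $(\tilde x_j,u_j)$ for some $j\le k$ or to $(\tilde x_k^a,u_k^a)$. *)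

(* Defs.v *)
From mathcomp Require Import all_boot all_order all_algebra.
From mathcomp Require Import all_classical all_reals all_analysis.

Set Implicit Arguments.
Unset Strict Implicit.
Unset Printing Implicit Defensive.

Import Order.TTheory GRing.Theory Num.Theory.
Import numFieldNormedType.Exports.
Local Open Scope classical_set_scope.
Local Open Scope ring_scope.

(* A real Hilbert space is a complete normed module [H] over a [realType]
   together with a real inner product [dot] (a symmetric positive definite
   bilinear form, [{dot H for idfun}]) that induces the norm of [H]. *)
Definition induces_norm (R : realType) (H : completeNormedModType R)
    (dot : {dot H for idfun}) : Prop :=
  forall x : H, `|x| = Num.sqrt (dot x x).

Definition closed_subspace (R : realType) (H : completeNormedModType R)
    (V : set H) : Prop :=
  [/\ V 0,
      forall (a : R) (x y : H), V x -> V y -> V (a *: x + y)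
    & closed V].

Definition orthocomp (R : realType) (H : completeNormedModType R)
    (dot : {dot H for idfun}) (V : set H) : set H :=
  [set w | forall v, V v -> dot w v = 0].

(* [xget 0] picks the (unique) point of [V] that differs from [x] by a vector
   orthogonal to [V]; it exists when [V] is a closed subspace. *)
Definition orthoproj (R : realType) (H : completeNormedModType R)
    (dot : {dot H for idfun}) (V : set H) (x : H) : H :=
  xget 0 [set p | V p /\ orthocomp dot V (x - p)].

(* A set-valued operator on [H] is a map [T : H -> set H]; [T x v] means that
   (x, v) belongs to its graph. *)
Definition monotone_op (R : realType) (H : completeNormedModType R)
    (dot : {dot H for idfun}) (T : H -> set H) : Prop :=
  forall x v x' v', T x v -> T x' v' -> 0 <= dot (v' - v) (x' - x).

Definition maximal_monotone (R : realType) (H : completeNormedModType R)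
    (dot : {dot H for idfun}) (T : H -> set H) : Prop :=
  monotone_op dot T /\
  forall S : H -> set H, monotone_op dot S ->
    (forall x, T x `<=` S x) -> forall x, S x = T x.

Definition enlargement (R : realType) (H : completeNormedModType R)
    (dot : {dot H for idfun}) (T : H -> set H) (eps : R) (x : H) : set H :=
  [set v | forall x' v', T x' v' -> - eps <= dot (v' - v) (x' - x)].

Definition solution_set (R : realType) (H : completeNormedModType R)
    (dot : {dot H for idfun}) (V : set H) (T : H -> set H) : set H :=
  [set z | exists x u, [/\ V x, orthocomp dot V u, T x u & z = x + u]].

Definition dist_to (R : realType) (H : completeNormedModType R)
    (x : H) (S : set H) : R :=
  inf [set `|x - z| | z in S].

(* The sequences [xt], [u] and [eps] start at index 1, so their values at 0
   are unconstrained; [x] starts at index 0. *)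
Definition algorithm2 (R : realType) (H : completeNormedModType R)
    (dot : {dot H for idfun}) (V : set H) (T : H -> set H) (sigma : R) (x0 : H)
    (x xt u : nat -> H) (eps : nat -> R) : Prop :=
  let P := orthoproj dot V in
  let Q := orthoproj dot (orthocomp dot V) in
  x 0%N = x0 /\
  forall k : nat,
    [/\ 0 <= eps k.+1,
        enlargement dot T (eps k.+1) (xt k.+1) (u k.+1),
        `|u k.+1 + xt k.+1 - x k| ^+ 2 + 2 * eps k.+1
          <= sigma ^+ 2 * `|P (xt k.+1) + Q (u k.+1) - x k| ^+ 2
      & x k.+1 = x k - (P (u k.+1) + Q (xt k.+1))].

Definition ergodic_mean (R : realType) (H : completeNormedModType R)
    (y : nat -> H) (k : nat) : H :=
  k%:R^-1 *: \sum_(1 <= l < k.+1) y l.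

(* Main.v *)
Require Import Defs.
From mathcomp Require Import all_boot all_order all_algebra.
From mathcomp Require Import all_classical all_reals all_analysis.
From mathcomp Require Import ring lra.

(** The partial inverse of [T] with respect to [V] is the operator whose graph
is the image of the graph of [T] under the map that sends (x, u) to
(P_V x + P_V' u, P_V u + P_V' x), where V' is the orthogonal complement of [V].
That map preserves both the sum and the inner product of the two components
([pinv_add], [dot_pinv]).  Hence solutions of the problem correspond to zeros of
the partial inverse, and in the variables
  z_k = P_V xt_k + P_V' u_k,    v_k = P_V u_k + P_V' xt_k
the algorithm is a hybrid proximal extragradient (HPE) iteration with unit step:
x_k = x_(k-1) - v_k, with |v_k + z_k - x_(k-1)|^2 + 2 eps_k bounded by
sigma^2 |z_k - x_(k-1)|^2.

Completing the square in that error criterion gives a telescoping inequality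
([hpe_step], [hpe_sum]).  Tested at a solution y, it says that x_k stays within
|y - x_0| of y and that the z_k stay in a ball about x_0 of radius K |y - x_0|,
with K = 3 / (1 - sigma^2).  Two consequences give the rates of the ergodic
averages.  First, the v_l sum to x_0 - x_k, so their mean is at most
2 |y - x_0| / k, and this mean dominates both distances |x - P_V x| and
|u - P_V' u| of the averaged pair ([ergodic_gap]).  Second, the averaged pair lies
in the enlargement of [T] with parameter the mean of the eps_l plus the empirical
covariance of the u_l and xt_l ([enlargement_mean]); this covariance is that of
the v_l and z_l, and the telescoping inequality tested at the mean of the z_l
bounds the parameter by K^2 |y - x_0|^2 / k ([ergodic_enlargement]).

Finally let M be the integer max(1, N).  Both d <= rho M and d^2 <= tol M, so with
m = min (rho M, sqrt (tol M)) one has d <= m and m > 0, and some solution y is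
closer to x_0 than 2 m.  Using this y instead of a nearest solution costs only a
constant factor, and k = C M iterations suffice as soon as C is at least 4 and
4 K^2. *)

Set Implicit Arguments.
Unset Strict Implicit.
Unset Printing Implicit Defensive.

Import Order.TTheory GRing.Theory Num.Theory.
Import numFieldNormedType.Exports.
Local Open Scope classical_set_scope.
Local Open Scope ring_scope.

(** * Inner products and the projection theorem *)

Section InnerProduct.
Context (R : realType) (H : completeNormedModType R) (dot : {dot H for idfun}).
Implicit Types (x y z v w : H) (a : R).

Lemma dotC x y : dot x y = dot y x.
Proof. by have := hermC dot x y; rewrite expr0 mul1r. Qed.

Lemma dotDl x y z : dot (x + y) z = dot x z + dot y z.
Proof. exact: linearDl. Qed.

Lemma dotNl x z : dot (- x) z = - dot x z.
Proof. exact: linearNl. Qed.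

Lemma dotZl a x z : dot (a *: x) z = a * dot x z.
Proof. exact: linearZl_LR. Qed.

Lemma dot0l z : dot 0 z = 0.
Proof. by rewrite -(scale0r 0) dotZl mul0r. Qed.

Lemma dotDr x y z : dot z (x + y) = dot z x + dot z y.
Proof. by rewrite dotC dotDl !(dotC z). Qed.

Lemma dotNr x z : dot z (- x) = - dot z x.
Proof. by rewrite dotC dotNl (dotC z). Qed.

Lemma dotZr a x z : dot z (a *: x) = a * dot z x.
Proof. by rewrite dotC dotZl (dotC z). Qed.

Definition dotE := (dotDl, dotDr, dotNl, dotNr, dotZl, dotZr).

Lemma dot_suml (I : Type) (r : seq I) (F : I -> H) z :
  dot (\sum_(i <- r) F i) z = \sum_(i <- r) dot (F i) z.
Proof.
exact: (big_morph (fun x => dot x z) (fun x y => dotDl x y z) (dot0l z)).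
Qed.

Lemma dot_sumr (I : Type) (r : seq I) (F : I -> H) z :
  dot z (\sum_(i <- r) F i) = \sum_(i <- r) dot z (F i).
Proof. by rewrite dotC dot_suml; apply: eq_bigr => i _; rewrite dotC. Qed.

Lemma dot_ge0 x : 0 <= dot x x.
Proof.
have [->|/neq0_dnorm_gt0/ltW //] := eqVneq x 0; by rewrite dot0l.
Qed.

Context (hdot : induces_norm dot).

Lemma sqr_norm x : `|x| ^+ 2 = dot x x.
Proof. by rewrite hdot sqr_sqrtr // dot_ge0. Qed.

End InnerProduct.

Section Projection.
Context (R : realType) (H : completeNormedModType R) (dot : {dot H for idfun}).
Context (hdot : induces_norm dot) (V : set H) (hV : closed_subspace V).

Let V0 : V 0. Proof. by case: hV. Qed.
Let VP a x y : V x -> V y -> V (a *: x + y). Proof. by case: hV => _ + _; apply. Qed.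
Let VZ a x : V x -> V (a *: x).
Proof. by move=> Vx; have := VP a Vx V0; rewrite addr0. Qed.
Let VD x y : V x -> V y -> V (x + y).
Proof. by move=> Vx Vy; have := VP 1 Vx Vy; rewrite scale1r. Qed.

(** The points of [V] that nearly minimise the distance to [x] generate a Cauchy
filter, by the parallelogram identity.  Its limit [p] attains the minimum, and
minimality along each line through [p] in [V] forces orthogonality. *)
Lemma proj_exists x : exists p, V p /\ orthocomp dot V (x - p).
Proof.
pose D : set R := [set `|x - v| | v in V]; pose m := inf D.
have Dinf : has_inf D.
  by split; [exists `|x - 0|, 0 | exists 0 => _ [v _ <-]].
have m_ge0 : 0 <= m.
  by apply: lb_le_inf; [case: Dinf | move=> _ [v _ <-]].
have le_m v : V v -> m <= `|x - v|.
  by move=> Vv; apply: ge_inf; [case: Dinf | exists v].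
pose B (e : R) : set H := [set v | V v /\ `|x - v| < m + e].
pose F := filter_from [set e : R | 0 < e] B.
have FB e : 0 < e -> F (B e) by move=> e0; exists e.
have FF : ProperFilter F.
  apply: filter_from_proper; last first.
    move=> e e0; have [_ [v Vv <-] vlt] := inf_adherent e0 Dinf.
    by exists v; split.
  apply: filter_from_filter; first by exists 1 => /=.
  move=> i j i0 j0; exists (Num.min i j); first by rewrite /= lt_min i0.
  move=> v [Vv vlt]; split; split => //; apply: (lt_le_trans vlt);
    by rewrite lerD2l ge_min lexx ?orbT.
have : cauchy F.
  apply/cauchy_ballP => e e0.
  pose e' := Num.min 1 (e ^+ 2 / (8 * m + 4)).
  have e'0 : 0 < e' by rewrite lt_min ltr01 divr_gt0 ?exprn_gt0 //; lra.
  have e'1 : e' <= 1 by rewrite ge_min lexx.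
  have e'e : e' * (8 * m + 4) <= e ^+ 2.
    by rewrite -ler_pdivlMr ?ge_min ?lexx ?orbT //; lra.
  exists (B e', B e'); first by split; exact: FB.
  move=> [v w] /= [[Vv vlt] [Vw wlt]].
  rewrite -ball_normE /ball_ /=.
  rewrite -(@ltr_pXn2r _ 2) ?nnegrE ?normr_ge0 ?ltW //.
  have := le_m _ (VZ 2^-1 (VD Vv Vw)) => lem.
  have lem2 : m ^+ 2 <= `|x - 2^-1 *: (v + w)| ^+ 2.
    by rewrite ler_pXn2r ?nnegrE.
  have v2 : `|x - v| ^+ 2 < (m + e') ^+ 2.
    by rewrite ltr_pXn2r ?nnegrE ?normr_ge0 //; lra.
  have w2 : `|x - w| ^+ 2 < (m + e') ^+ 2.
    by rewrite ltr_pXn2r ?nnegrE ?normr_ge0 //; lra.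
  (* Parallelogram identity: |v - w|^2 = 2 |x - v|^2 + 2 |x - w|^2
     - 4 |x - (v + w) / 2|^2, which is below 8 m e' + 4 e'^2. *)
  move: lem2 v2 w2; rewrite !(sqr_norm hdot) !dotE (dotC dot v x) (dotC dot w x).
  rewrite (dotC dot w v) => lem2 v2 w2.
  have : e' ^+ 2 <= e' by rewrite expr2 ler_piMl // ltW.
  nra.
move=> /cauchy_cvg /cvg_ex [p Fp].
have Vp : V p.
  case: hV => _ _ clV; apply: clV => A /Fp FA.
  by have [v [[Vv _] Av]] := filter_ex (filterI (FB 1 ltr01) FA); exists v.
have xp : `|x - p| <= m.
  apply/ler_addgt0Pr => e e0.
  have e20 : 0 < e / 2 by rewrite divr_gt0.
  have FBe := FB _ e20.
  have Fb := Fp _ (nbhsx_ballx p (e / 2) e20).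
  have [v [[Vv vlt] pv]] := filter_ex (filterI FBe Fb).
  rewrite -ball_normE /ball_ /= in pv.
  have := ler_distD v x p; rewrite (distrC v p); lra.
exists p; split => // w Vw.
have [->|w0] := eqVneq w 0; first by rewrite dotC dot0l.
have : 0 < dot w w by exact: neq0_dnorm_gt0.
set b := dot w w => b0.
set a := dot (x - p) w.
(* c minimises t |-> |x - p - t w|^2, whose minimum |x - p|^2 - a^2 / b cannot be
   smaller than |x - p|^2. *)
have ab : a = a / b * b by rewrite divfK // gt_eqF.
set c := a / b in ab.
have : `|x - p| ^+ 2 <= `|x - p - c *: w| ^+ 2.
  rewrite ler_pXn2r ?nnegrE //; apply: (le_trans xp).
  by rewrite -addrA -opprD; apply: le_m; apply: VD => //; exact: VZ.
have -> : `|x - p - c *: w| ^+ 2 = `|x - p| ^+ 2 - 2 * c * a + c ^+ 2 * b.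
  rewrite !(sqr_norm hdot) /a /b.
  move: (x - p) (c) => q t; rewrite !dotE (dotC dot w q).
  by ring.
rewrite ab => le; have c2 : c ^+ 2 * b <= 0 by lra.
rewrite pmulr_lle0 // in c2.
have /eqP : c ^+ 2 = 0 by apply/eqP; rewrite eq_le c2 sqr_ge0.
by rewrite sqrf_eq0 => /eqP ->; rewrite mul0r.
Qed.
End Projection.

(** * Orthogonal projections and the partial inverse map *)

Section Orthoproj.
Context (R : realType) (H : completeNormedModType R) (dot : {dot H for idfun}).
Context (hdot : induces_norm dot) (V : set H) (hV : closed_subspace V).

Let Vc := orthocomp dot V.
Let P := orthoproj dot V.
Let Q := orthoproj dot Vc.

Lemma orthoproj_uniq (W : set H) x p :
    (forall a y z, W y -> W z -> W (a *: y + z)) ->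
    W p -> orthocomp dot W (x - p) -> orthoproj dot W x = p.
Proof.
move=> WP Wp op; have := @xgetPex _ 0 _ (ex_intro
  [set q | W q /\ orthocomp dot W (x - q)] p (conj Wp op)).
rewrite /orthoproj; set q := xget _ _ => -[Wq oq].
have Wpq : W (q - p) by rewrite addrC -scaleN1r; exact: WP.
have : dot (q - p) (q - p) = 0.
  have -> : dot (q - p) (q - p) = dot (x - p) (q - p) - dot (x - q) (q - p).
    by rewrite -dotNl -dotDl opprB [x - p + _]addrC subrKA.
  by rewrite op // oq // subrr.
rewrite -(sqr_norm hdot) => /eqP; rewrite sqrf_eq0 normr_eq0 subr_eq0.
by move/eqP.
Qed.

Lemma orthocomp_subspace (W : set H) a y z :
  orthocomp dot W y -> orthocomp dot W z -> orthocomp dot W (a *: y + z).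
Proof. by move=> oy oz v Wv; rewrite !dotE oy // oz // mulr0 addr0. Qed.

Let VP a x y : V x -> V y -> V (a *: x + y). Proof. by case: hV => _ + _; apply. Qed.

Lemma orthoproj_in x : V (P x).
Proof.
by have [p [Vp op]] := proj_exists hdot hV x; rewrite /P (orthoproj_uniq _ Vp op).
Qed.

Lemma orthoproj_residual x : Vc (x - P x).
Proof.
by have [p [Vp op]] := proj_exists hdot hV x; rewrite /P (orthoproj_uniq _ Vp op).
Qed.

(** No second minimisation is needed: [P x], being in [V], is orthogonal to the
orthocomplement, so [x - P x] is already the projection of [x] onto it. *)
Lemma orthoproj_orthocomp x : Q x = x - P x.
Proof.
apply: orthoproj_uniq; first exact: orthocomp_subspace.
  exact: orthoproj_residual.
move=> v Vv; rewrite subKr dotC; apply: Vv; exact: orthoproj_in.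
Qed.

Lemma orthoproj_linear : linear P.
Proof.
move=> a x y; apply: orthoproj_uniq => //.
  by apply: VP; exact: orthoproj_in.
have -> : a *: x + y - (a *: P x + P y) = a *: (x - P x) + (y - P y).
  by rewrite opprD addrACA scalerBr.
by apply: orthocomp_subspace; exact: orthoproj_residual.
Qed.

(** The graph of Spingarn's partial inverse of an operator consists of the pairs
([pinv x u], [pinv u x]) for (x, u) in the graph of the operator. *)
Definition pinv x y := P x + Q y.

Let dotPQ x y : dot (P x) (Q y) = 0.
Proof.
by rewrite dotC orthoproj_orthocomp orthoproj_residual //; exact: orthoproj_in.
Qed.

Let PQ x : x = P x + Q x.
Proof. by rewrite orthoproj_orthocomp addrC subrK. Qed.

(** The map swaps the components of [x] and [y] orthogonal to [V], which leaves the
two nonzero terms <P x, P y> and <Q x, Q y> of the inner product in place.  This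
is why the partial inverse of a monotone operator is monotone. *)
Lemma dot_pinv x y : dot (pinv x y) (pinv y x) = dot x y.
Proof.
rewrite [in RHS](PQ x) [in RHS](PQ y) /pinv !dotDl !dotDr.
by rewrite !dotPQ ![dot (Q _) (P _)]dotC !dotPQ (dotC dot (Q y)); ring.
Qed.

Lemma pinv_add x y : pinv x y + pinv y x = x + y.
Proof. by rewrite /pinv addrACA [Q y + _]addrC addrACA -!PQ. Qed.

Lemma pinv_linear a x y x' y' :
  pinv (a *: x + x') (a *: y + y') = a *: pinv x y + pinv x' y'.
Proof.
rewrite /pinv !orthoproj_orthocomp !orthoproj_linear.
by rewrite opprD [a *: y + _ + _]addrACA -scalerBr addrACA -scalerDr.
Qed.

Lemma pinv0 : pinv 0 0 = 0.
Proof.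
have := pinv_linear (-1) 0 0 0 0; rewrite scaler0 add0r scaleN1r addNr //.
Qed.

Lemma pinvZ a x y : pinv (a *: x) (a *: y) = a *: pinv x y.
Proof. by have := pinv_linear a x y 0 0; rewrite pinv0 !addr0. Qed.

Lemma pinvB x y x' y' : pinv (x - x') (y - y') = pinv x y - pinv x' y'.
Proof.
have := pinv_linear (-1) x' y' x y.
by rewrite !scaleN1r ![- _ + _]addrC.
Qed.

Lemma pinv_sum (r : seq nat) (F G : nat -> H) :
  pinv (\sum_(i <- r) F i) (\sum_(i <- r) G i) = \sum_(i <- r) pinv (F i) (G i).
Proof.
elim: r => [|i r IH]; first by rewrite !big_nil pinv0.
rewrite !big_cons -IH -[F i]scale1r -[G i]scale1r pinv_linear.
by rewrite !scale1r.
Qed.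

Lemma norm_pinv x y : `|pinv x y| ^+ 2 = `|P x| ^+ 2 + `|Q y| ^+ 2.
Proof.
rewrite !(sqr_norm hdot) /pinv !dotDl !dotDr dotPQ (dotC dot (Q y)) dotPQ.
by ring.
Qed.

Lemma norm_Ppinv x y : `|P x| <= `|pinv x y|.
Proof.
rewrite -(@ler_pXn2r _ 2) ?nnegrE // norm_pinv lerDl; exact: sqr_ge0.
Qed.

Lemma norm_Qpinv x y : `|Q y| <= `|pinv x y|.
Proof.
rewrite -(@ler_pXn2r _ 2) ?nnegrE // norm_pinv lerDr; exact: sqr_ge0.
Qed.

(** A solution of the problem is a zero of the partial inverse. *)
Lemma pinv_sol x y : V x -> Vc y -> pinv x y = x + y /\ pinv y x = 0.
Proof.
move=> Vx oy.
have Px : P x = x by apply: orthoproj_uniq => //; rewrite subrr => v _; exact: dot0l.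
have Py : P y = 0.
  apply: orthoproj_uniq => //; [by case: hV | by rewrite subr0].
by rewrite /pinv !orthoproj_orthocomp Px Py subr0 subrr addr0.
Qed.
End Orthoproj.

(** * Hybrid proximal extragradient iterations *)

Section Hpe.
Context (R : realType) (H : completeNormedModType R) (dot : {dot H for idfun}).
Context (hdot : induces_norm dot).

(** Since |y - x|^2 - |y - (x - v)|^2 = - |v|^2 - 2 <v, y - x>, and the criterion
bounds - |v|^2 - 2 <v, z - x> below by (1 - s) |z - x|^2 + 2 e, the two differ by
2 <v, z - y>. *)
Lemma hpe_step (s e : R) (x z v y : H) :
  `|v + z - x| ^+ 2 + 2 * e <= s * `|z - x| ^+ 2 ->
  (1 - s) * `|z - x| ^+ 2 + 2 * (dot v (z - y) + e) + `|y - (x - v)| ^+ 2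
    <= `|y - x| ^+ 2.
Proof.
rewrite !(sqr_norm hdot) !dotE.
rewrite (dotC dot z x) (dotC dot z v) (dotC dot x v) (dotC dot y v).
rewrite (dotC dot y x); lra.
Qed.

Context (s : R) (hs : 0 <= s < 1) (x z v : nat -> H) (e : nat -> R).
Context (hx : forall k, x k.+1 = x k - v k.+1).
Context (he : forall k, `|v k.+1 + z k.+1 - x k| ^+ 2 + 2 * e k.+1
                  <= s * `|z k.+1 - x k| ^+ 2).

Let s0 : 0 <= s. Proof. by case/andP: hs. Qed.
Let s1 : 0 < 1 - s. Proof. by rewrite subr_gt0; case/andP: hs. Qed.

(** This holds for every point [y]; it is used both at a solution and at the mean of
the [z l]. *)
Lemma hpe_sum y k :
  2 * (\sum_(1 <= l < k.+1) (dot (v l) (z l - y) + e l)) + `|y - x k| ^+ 2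
    <= `|y - x 0%N| ^+ 2.
Proof.
elim: k => [|k IH]; first by rewrite big_geq // mulr0 add0r.
rewrite big_nat_recr //= hx; have := hpe_step y (he k).
have : 0 <= (1 - s) * `|z k.+1 - x k| ^+ 2.
  by rewrite mulr_ge0 ?sqr_ge0 // ltW.
lra.
Qed.

Lemma sum_step k : \sum_(1 <= l < k.+1) v l = x 0%N - x k.
Proof.
elim: k => [|k IH]; first by rewrite big_geq // subrr.
by rewrite big_nat_recr //= IH hx opprB -addrA (addrC (v _)).
Qed.

(** The hypothesis on [y] below holds when [y] is a zero of a monotone operator
whose [e l]-enlargement contains the pair ([z l], [v l]). *)
Section Sol.
Context (y : H) (hy : forall k, - e k.+1 <= dot (v k.+1) (z k.+1 - y)).

Lemma hpe_fejer k : `|y - x k| <= `|y - x 0%N|.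
Proof.
rewrite -(@ler_pXn2r _ 2) ?nnegrE //; apply: le_trans (hpe_sum y k).
rewrite lerDr mulr_ge0 // big_nat_cond sumr_ge0 // => -[//|l] _.
by have := hy l; lra.
Qed.

Lemma hpe_dist k : `|x 0%N - x k| <= 2 * `|y - x 0%N|.
Proof.
have := ler_distD y (x 0%N) (x k); have := hpe_fejer k; rewrite (distrC y (x 0%N)).
lra.
Qed.

(** [hpe_step] gives the factor (1 - s)^(-1/2); as 1 - s <= 1, the rational factor
(1 - s)^-1 is at least as large and avoids the square root. *)
Lemma hpe_resid k : `|z k.+1 - x k| <= (1 - s)^-1 * `|y - x 0%N|.
Proof.
have i0 : 0 <= (1 - s)^-1 by rewrite invr_ge0 ltW.
rewrite -(@ler_pXn2r _ 2) ?nnegrE ?mulr_ge0 //.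
have st := hpe_step y (he k).
have fe : `|y - x k| ^+ 2 <= `|y - x 0%N| ^+ 2.
  by rewrite ler_pXn2r ?nnegrE //; exact: hpe_fejer.
have := hy k => hyk.
have := sqr_ge0 (`|y - (x k - v k.+1)|) => q.
have : (1 - s) * `|z k.+1 - x k| ^+ 2 <= `|y - x 0%N| ^+ 2 by lra.
rewrite mulrC -ler_pdivlMr // => /le_trans; apply.
rewrite exprMn mulrC ler_wpM2r ?sqr_ge0 // expr2 ler_pMl ?invr_gt0 //.
by rewrite invf_ge1 // gerBl.
Qed.

Lemma hpe_trial k : `|z k.+1 - x 0%N| <= 3 / (1 - s) * `|y - x 0%N|.
Proof.
have := ler_distD (x k) (z k.+1) (x 0%N); have := hpe_resid k.
have := hpe_dist k; rewrite (distrC (x 0%N)).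
have : `|y - x 0%N| <= (1 - s)^-1 * `|y - x 0%N|.
  by rewrite ler_peMl // invf_ge1 // gerBl.
lra.
Qed.

Lemma hpe_mean_trial k : (0 < k)%N ->
  `|ergodic_mean z k - x 0%N| <= 3 / (1 - s) * `|y - x 0%N|.
Proof.
move=> k0; set D := (3 / _ * _).
have kR : (0 : R) < k%:R by rewrite ltr0n.
have -> : ergodic_mean z k - x 0%N = k%:R^-1 *: \sum_(1 <= l < k.+1) (z l - x 0%N).
  rewrite sumrB sumr_const_nat subn1 /= scalerBr -[X in _ *: (X *+ k)]scale1r.
  by rewrite scalerMnl scalerA mulVf ?gt_eqF // scale1r.
rewrite normrZ ger0_norm ?invr_ge0 ?ler0n // ler_pdivrMl // mulr_natl.
apply: (le_trans (ler_norm_sum _ _ _)).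
have -> : D *+ k = \sum_(1 <= l < k.+1) D by rewrite sumr_const_nat subn1.
by apply: ler_sum_nat => -[//|l] _; exact: hpe_trial.
Qed.

Lemma hpe_ergodic_step k : (0 < k)%N -> `|ergodic_mean v k| <= 2 * `|y - x 0%N| / k%:R.
Proof.
move=> k0; rewrite /ergodic_mean sum_step normrZ ger0_norm ?invr_ge0 ?ler0n //.
by rewrite mulrC ler_wpM2r ?invr_ge0 ?ler0n // hpe_dist.
Qed.

(** Testing [hpe_sum] at the mean leaves the squared distance of the mean to the
starting point, which convexity of the ball bounds. *)
Lemma hpe_ergodic_error k : (0 < k)%N ->
  2 * \sum_(1 <= l < k.+1) (dot (v l) (z l - ergodic_mean z k) + e l)
    <= (3 / (1 - s) * `|y - x 0%N|) ^+ 2.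
Proof.
move=> k0; have := hpe_sum (ergodic_mean z k) k.
have : `|ergodic_mean z k - x 0%N| ^+ 2 <= (3 / (1 - s) * `|y - x 0%N|) ^+ 2.
  rewrite ler_pXn2r ?nnegrE ?hpe_mean_trial //.
  by rewrite mulr_ge0 // divr_ge0 // ltW.
have := sqr_ge0 `|ergodic_mean z k - x k|.
lra.
Qed.
End Sol.
End Hpe.

(** * Averaging in the enlargement *)

Section Enlargement.
Context (R : realType) (H : completeNormedModType R) (dot : {dot H for idfun}).
Context (T : H -> set H).

(** The empirical covariance of [a l] and [b l], times the number [k] of samples. *)
Definition covariance (a b : nat -> H) k : R :=
  \sum_(1 <= l < k.+1) dot (a l) (b l)
    - k%:R * dot (ergodic_mean a k) (ergodic_mean b k).

Lemma sum_ergodic_mean (a : nat -> H) k : (0 < k)%N ->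
  \sum_(1 <= l < k.+1) a l = k%:R *: ergodic_mean a k.
Proof.
by move=> k0; rewrite /ergodic_mean scalerA divff ?scale1r // pnatr_eq0 -lt0n.
Qed.

Lemma covarianceE (a b : nat -> H) k : (0 < k)%N ->
  covariance a b k = \sum_(1 <= l < k.+1) dot (a l) (b l - ergodic_mean b k).
Proof.
move=> k0; under eq_bigr do rewrite dotDr dotNr.
by rewrite sumrB -dot_suml sum_ergodic_mean // dotZl.
Qed.

(** The transportation formula: averaging the inequalities
<v' - u l, x' - x l> >= - e l over [l] gives, on the left, the inner product for
the averaged pair plus the empirical covariance. *)
Lemma enlargement_mean (e : nat -> R) (x u : nat -> H) k : (0 < k)%N ->
    (forall l, enlargement dot T (e l.+1) (x l.+1) (u l.+1)) ->
  enlargement dot T ((\sum_(1 <= l < k.+1) e l + covariance u x k) / k%:R)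
    (ergodic_mean x k) (ergodic_mean u k).
Proof.
move=> k0 he x' v' Tx'.
have kR : (0 : R) < k%:R by rewrite ltr0n.
have : - \sum_(1 <= l < k.+1) e l <= \sum_(1 <= l < k.+1) dot (v' - u l) (x' - x l).
  by rewrite -sumrN; apply: ler_sum_nat => -[//|l] _; exact: he.
under [X in _ <= X]eq_bigr do rewrite dotDl dotNl !dotDr !dotNr opprB.
rewrite big_split sumrB sumrB /=.
rewrite sumr_const_nat subn1 -dot_sumr -dot_suml !sum_ergodic_mean //= dotZr dotZl.
rewrite -[dot v' x' *+ k]mulr_natl => le; rewrite -mulNr ler_pdivrMr //; move: le.
rewrite /covariance !dotE; lra.
Qed.

Lemma enlargement_le e e' x v :
  e <= e' -> enlargement dot T e x v -> enlargement dot T e' x v.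
Proof. by move=> ee h x' v' /h; apply: le_trans; rewrite lerN2. Qed.
End Enlargement.

(** * Ergodic rates of the inexact partial inverse method *)

Section PartialInverse.
Context (R : realType) (H : completeNormedModType R) (dot : {dot H for idfun}).
Context (hdot : induces_norm dot) (V : set H) (hV : closed_subspace V).
Local Notation pinv := (pinv dot V).

Lemma pinv_ergodic_mean (a b : nat -> H) k :
  pinv (ergodic_mean a k) (ergodic_mean b k)
    = ergodic_mean (fun l => pinv (a l) (b l)) k.
Proof. by rewrite /ergodic_mean pinvZ // pinv_sum. Qed.

(** The covariance is made of inner products, which [pinv] preserves, and of means,
with which [pinv] commutes. *)
Lemma covariance_pinv (a b : nat -> H) k :
  covariance dot (fun l => pinv (a l) (b l)) (fun l => pinv (b l) (a l)) k
    = covariance dot a b k.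
Proof.
rewrite /covariance -!pinv_ergodic_mean dot_pinv //; congr (_ - _).
by apply: eq_bigr => l _; exact: dot_pinv.
Qed.

Lemma solution_monotone T x v e y : solution_set dot V T y ->
  enlargement dot T e x v -> - e <= dot (pinv v x) (pinv x v - y).
Proof.
move=> [x' [v' [Vx' ov' Tx' ->]]] /(_ _ _ Tx').
have [<- v0] := pinv_sol hdot hV Vx' ov'.
rewrite -[pinv v x]subr0 -v0 -!pinvB // dot_pinv //.
by rewrite -(opprB v) -(opprB x) dotNl dotNr opprK.
Qed.

Section Run.
Context (T : H -> set H) (sigma : R) (hsigma : 0 <= sigma < 1).
Context (x0 : H) (x xt u : nat -> H) (eps : nat -> R).
Context (hrun : algorithm2 dot V T sigma x0 x xt u eps).
Context (y : H) (hy : solution_set dot V T y).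

Let z l := pinv (xt l) (u l).
Let v l := pinv (u l) (xt l).

Let hs : 0 <= sigma ^+ 2 < 1.
Proof.
by case/andP: hsigma => s0 s1; rewrite sqr_ge0 expr_lt1.
Qed.

Let hx k : x k.+1 = x k - v k.+1.
Proof. by case: hrun => _ /(_ k) []. Qed.

Let he k : `|v k.+1 + z k.+1 - x k| ^+ 2 + 2 * eps k.+1
  <= sigma ^+ 2 * `|z k.+1 - x k| ^+ 2.
Proof. by rewrite /v /z pinv_add //; case: hrun => _ /(_ k) []. Qed.

Let hsol k : - eps k.+1 <= dot (v k.+1) (z k.+1 - y).
Proof. by apply: solution_monotone hy _; case: hrun => _ /(_ k) []. Qed.

(** The two distances are the norms of the orthogonal components of the mean of the
[v l]. *)
Lemma ergodic_gap k : (0 < k)%N ->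
  Num.max `|ergodic_mean xt k - orthoproj dot V (ergodic_mean xt k)|
    `|ergodic_mean u k
       - orthoproj dot (orthocomp dot V) (ergodic_mean u k)|
   <= 2 * `|y - x0| / k%:R.
Proof.
move=> k0; case: (hrun) => <- _.
have := hpe_ergodic_step hdot hs hx he hsol k0.
rewrite -pinv_ergodic_mean => le; rewrite ge_max.
rewrite -[X in `|X|](orthoproj_orthocomp hdot hV).
rewrite (orthoproj_orthocomp hdot hV (ergodic_mean u k)) subKr.
by rewrite !(le_trans _ le) // ?norm_Ppinv ?norm_Qpinv.
Qed.

(** [covariance_pinv] turns the parameter of the transportation formula into the
sum that [hpe_ergodic_error] bounds. *)
Lemma ergodic_enlargement k : (0 < k)%N ->
  enlargement dot T ((3 / (1 - sigma ^+ 2) * `|y - x0|) ^+ 2 / k%:R)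
    (ergodic_mean xt k) (ergodic_mean u k).
Proof.
move=> k0; case: (hrun) => <- _.
apply: enlargement_le (enlargement_mean k0 (e := eps) _); last first.
  by move=> l; case: hrun => _ /(_ l) [].
rewrite ler_wpM2r ?invr_ge0 ?ler0n //.
rewrite -covariance_pinv covarianceE // addrC -big_split /=.
have := hpe_ergodic_error hdot hs hx he hsol k0.
have := sqr_ge0 (3 / (1 - sigma ^+ 2) * `|y - x 0%N|).
rewrite /z /v; lra.
Qed.
End Run.
End PartialInverse.

Theorem theorem3p2 (R : realType) (sigma : R) (hsigma : 0 <= sigma < 1) :
  exists C : R,
  forall (H : completeNormedModType R) (dot : {dot H for idfun})
    (hdot : induces_norm dot)
    (V : set H) (hV : closed_subspace V)
    (T : H -> set H) (hT : maximal_monotone dot T)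
    (hS : solution_set dot V T !=set0)
    (x0 : H) (x xt u : nat -> H) (eps : nat -> R)
    (hrun : algorithm2 dot V T sigma x0 x xt u eps)
    (rho tol : R) (hrho : 0 < rho) (htol : 0 < tol),
  let d := dist_to x0 (solution_set dot V T) in
  let N : int := Num.max (Num.ceil (d / rho)) (Num.ceil (d ^+ 2 / tol)) in
  exists k : nat,
    [/\ (1 <= k)%N,
        k%:R <= C * (Num.max 1 N)%:~R
      & exists (y w : H) (e : R),
        [/\ (exists j : nat, [/\ (1 <= j <= k)%N, y = xt j & w = u j]) \/
              (y = ergodic_mean xt k /\ w = ergodic_mean u k),
            0 < e,
            enlargement dot T e y w,
            Num.max `|y - orthoproj dot V y|
                    `|w - orthoproj dot (orthocomp dot V) w| <= rho
          & e <= tol]].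
Proof.
set K := 3 / (1 - sigma ^+ 2).
pose C := (Num.bound (4 * K ^+ 2)).+4; exists C%:R.
have KC : 4 * K ^+ 2 <= C%:R.
  apply: ltW; apply: (lt_le_trans (archi_boundP _)).
    by rewrite mulr_ge0 // sqr_ge0.
  by rewrite ler_nat; do 4 apply: leqW.
have C4 : (4 : R) <= C%:R by rewrite ler_nat.
move=> H dot hdot V hV T hT hS x0 x xt u eps hrun rho tol hrho htol d N.
have M1 : 1 <= Num.max 1 N by rewrite le_max lexx.
have [M ME] : exists M : nat, Num.max 1 N = M%:Z.
  by exists (absz (Num.max 1 N)); rewrite gez0_abs // (le_trans _ M1).
have dM1 : d <= rho * M%:R.
  rewrite mulrC -ler_pdivrMr // (le_trans (ceil_ge _)) // -[M%:R]/(M%:Z%:~R) -ME.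
  by rewrite ler_int !le_max lexx !orbT.
have dM2 : d ^+ 2 <= tol * M%:R.
  rewrite mulrC -ler_pdivrMr // (le_trans (ceil_ge _)) // -[M%:R]/(M%:Z%:~R) -ME.
  by rewrite ler_int !le_max lexx !orbT.
have M0 : (0 < M)%N by move: M1; rewrite ME.
have MR : (0 : R) < M%:R by rewrite ltr0n.
have Dinf : has_inf [set `|x0 - z| | z in solution_set dot V T].
  by case: hS => z Sz; split; [exists `|x0 - z|, z | exists 0 => _ [v _ <-]].
have d0 : 0 <= d.
  by apply: lb_le_inf; [case: Dinf | move=> _ [v _ <-]].
(* m is positive even if d = 0, so that a solution closer to x0 than d + m
   exists without the distance being attained. *)
pose m := Num.min (rho * M%:R) (Num.sqrt (tol * M%:R)).
have m0 : 0 < m by rewrite lt_min sqrtr_gt0 !mulr_gt0.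
have dm : d <= m.
  by rewrite le_min dM1 /= -[d]ger0_norm // -sqrtr_sqr ler_wsqrtr.
have m1 : m <= rho * M%:R by rewrite ge_min lexx.
have m2 : m ^+ 2 <= tol * M%:R.
  have tM0 : 0 <= tol * M%:R by rewrite mulr_ge0 // ltW.
  have m0' := ltW m0.
  rewrite -[leRHS]sqr_sqrtr // ler_pXn2r ?nnegrE ?sqrtr_ge0 //.
  by rewrite ge_min lexx orbT.
have [_ [y Sy <-]] := inf_adherent m0 Dinf.
rewrite -/(dist_to x0 (solution_set dot V T)) -/d distrC => ylt.
have y2m : `|y - x0| <= 2 * m by lra.
have k0 : (0 < C * M)%N by rewrite muln_gt0 M0.
have kR : (0 : R) < (C * M)%:R by rewrite ltr0n.
exists (C * M)%N; split => //; first by rewrite ME natrM.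
exists (ergodic_mean xt (C * M)), (ergodic_mean u (C * M)), tol.
split => //; first by right.
- apply: enlargement_le (ergodic_enlargement hdot hV hsigma hrun Sy k0).
  rewrite -/K ler_pdivrMr // natrM exprMn.
  have y2 : `|y - x0| ^+ 2 <= 4 * m ^+ 2.
    rewrite (_ : 4 * m ^+ 2 = (2 * m) ^+ 2); last by ring.
    by rewrite ler_pXn2r ?nnegrE // mulr_ge0 // ltW.
  apply: (@le_trans _ _ (4 * K ^+ 2 * m ^+ 2)).
    by rewrite [4 * _]mulrC -[leRHS]mulrA ler_wpM2l ?sqr_ge0.
  apply: (@le_trans _ _ (C%:R * (tol * M%:R))); last by rewrite mulrCA.
  by apply: ler_pM => //; [rewrite mulr_ge0 ?sqr_ge0 | exact: sqr_ge0].
- apply: le_trans (ergodic_gap hdot hV hsigma hrun Sy k0) _.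
  rewrite ler_pdivrMr // natrM.
  apply: (@le_trans _ _ (4 * (rho * M%:R))); first by lra.
  by rewrite [leRHS]mulrCA ler_wpM2r // mulr_ge0 // ltW.
Qed.
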